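(* Let $(S,\cdot,\ast)$ be a regular $\star$-semigroup. Define binary operations $+$ and $\oplus$ on $S$ by $a+b=a^{\ast}ba$ and $a\oplus b=bab^{\ast}$ for all $a,b\in S$. Let $\boxplus$ denote either one of $+$, $\oplus$. Then (for each of the two choices of $\boxplus$) the following statements are equivalent: (1) $x(y\boxplus z)=xy\boxplus x(x^{\ast}\boxplus z)$ for all $x,y,z\in S$. (2) $(z\boxplus y)x=(z\boxplus x^{\ast})x\boxplus yx$ for all $x,y,z\in S$. (3) $(S,\cdot)$ is commutative. If (3) holds, then $(S,\boxplus)$ is a semigroup. Thus $(S,\boxplus,\cdot,\ast)$ is a left (or equivalently, right; or equivalently, two-sided) regular $\star$-semibrace if and only if $(S,\cdot)$ is commutative.
   Context: A regular $\star$-semigroup is a triple $(S,\cdot,\ast)$ where $(S,\cdot)$ is a semigroup on a non-empty set and $\ast:S\to S$, $x\mapsto x^\ast$, satisfies $xx^\ast x=x$, $(x^\ast)^\ast=x$, $(xy)^\ast=y^\ast x^\ast$ for all $x,y\in S$. Let $(S,\boxplus,\cdot,\ast)$ be such that $(S,\boxplus)$ is a semigroup and $(S,\cdot,\ast)$ is a regular $\star$-semigroup. It is a left regular $\star$-semibrace if $x(y\boxplus z)=xy\boxplus x(x^{\ast}\boxplus z)$ for all $x,y,z\in S$; a right regular $\star$-semibrace if $(z\boxplus y)x=(z\boxplus x^{\ast})x\boxplus yx$ for all $x,y,z\in S$; two-sided if both hold. Multiplication has precedence over $+$, $\oplus$, $\boxplus$. *)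

(* Defs.v *)
From mathcomp Require Import ssreflect ssrfun ssrbool.

Set Implicit Arguments.
Unset Strict Implicit.
Unset Printing Implicit Defensive.

Definition semigroup (S : Type) (op : S -> S -> S) : Prop :=
  inhabited S /\ associative op.

Definition regular_star_semigroup (S : Type) (mul : S -> S -> S)
    (star : S -> S) : Prop :=
  [/\ semigroup mul,
      forall x, mul (mul x (star x)) x = x,
      forall x, star (star x) = x &
      forall x y, star (mul x y) = mul (star y) (star x)].

Definition left_semibrace_law (S : Type) (bplus mul : S -> S -> S)
    (star : S -> S) : Prop :=
  forall x y z : S,
    mul x (bplus y z) = bplus (mul x y) (mul x (bplus (star x) z)).

Definition right_semibrace_law (S : Type) (bplus mul : S -> S -> S)
    (star : S -> S) : Prop :=
  forall x y z : S,
    mul (bplus z y) x = bplus (mul (bplus z (star x)) x) (mul y x).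

Definition left_regular_star_semibrace (S : Type) (bplus mul : S -> S -> S)
    (star : S -> S) : Prop :=
  [/\ semigroup bplus, regular_star_semigroup mul star &
      left_semibrace_law bplus mul star].

Definition right_regular_star_semibrace (S : Type) (bplus mul : S -> S -> S)
    (star : S -> S) : Prop :=
  [/\ semigroup bplus, regular_star_semigroup mul star &
      right_semibrace_law bplus mul star].

Definition two_sided_regular_star_semibrace (S : Type)
    (bplus mul : S -> S -> S) (star : S -> S) : Prop :=
  left_regular_star_semibrace bplus mul star /\
  right_regular_star_semibrace bplus mul star.

Definition star_plus (S : Type) (mul : S -> S -> S) (star : S -> S)
    (a b : S) : S := mul (mul (star a) b) a.

Definition star_oplus (S : Type) (mul : S -> S -> S) (star : S -> S)
    (a b : S) : S := mul (mul b a) (star b).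

(* Main.v *)
Require Import Defs.
From mathcomp Require Import ssreflect ssrfun ssrbool.

(** Call [p] a projection if [p = p* = pp].  Each of the two laws for [+],
    evaluated at projections [p], [q], expresses [pq] as a palindrome in [p] and
    [q]; hence [pq] is fixed by [*], that is, [pq = qp].  Evaluated at [x] and
    [xx*] or [x*x], it gives [x = x*xx], whence [xx* = x*x].  These facts make
    projections central, and a last evaluation gives [xy = yx].  The laws for
    [oplus] are those for [+] in the opposite semigroup, left and right being
    exchanged. *)

Section RegularStar.
Context (S : Type) (mul : S -> S -> S) (star : S -> S).
Context (HS : regular_star_semigroup mul star).

Local Notation "x * y" := (mul x y).
Local Notation "x ^*" := (star x).

Let mulA : associative mul. Proof. by case: HS => -[]. Qed.
Let mulxsx x : x * x^* * x = x. Proof. by case: HS. Qed.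
Let starK : involutive star. Proof. by case: HS. Qed.
Let starM x y : (x * y)^* = y^* * x^*. Proof. by case: HS. Qed.

Let mulsxs x : x^* * x * x^* = x^*. Proof. by rewrite -{2}[x]starK mulxsx. Qed.

(** [mulA] nests words to the left, so a contraction in the middle of a word needs a version with a
    prefix [y]. *)
Let mulKxsx y x : y * x * x^* * x = y * x.
Proof. by rewrite -!mulA [x * _]mulA mulxsx. Qed.

Let mulKsxs y x : y * x^* * x * x^* = y * x^*.
Proof. by rewrite -!mulA [x^* * _]mulA mulsxs. Qed.

Let mulKpp y p : p * p = p -> y * p * p = y * p.
Proof. by rewrite -mulA => ->. Qed.

Definition projection p := p^* = p /\ p * p = p.

Lemma projection_star_mul x : projection (x^* * x).
Proof. by rewrite /projection starM starK mulA mulsxs. Qed.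

(** Starring the hypothesis at [x^*] gives [x * x * x^* = x]; so both sides equal
    [x^* * x * x * x^*]. *)
Lemma star_mul_comm : (forall x, x^* * x * x = x) ->
  forall x, x^* * x = x * x^*.
Proof.
move=> xsxx x.
have xxxs : x * x * x^* = x.
  by have := congr1 star (xsxx x^*); rewrite !starM !starK mulA.
by rewrite -{2}[x]xxxs !mulA xsxx.
Qed.

Lemma left_law_plusE : left_semibrace_law (star_plus mul star) mul star ->
  forall x y z, x * y^* * z * y = y^* * x^* * x * x * z * x^* * x * y.
Proof.
by move=> H x y z; have := H x y z; rewrite /star_plus !starM !starK !mulA.
Qed.

Lemma right_law_plusE : right_semibrace_law (star_plus mul star) mul star ->
  forall x y z, z^* * y * z * x =
    x^* * z^* * x * z * y * x * z^* * x^* * z * x.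
Proof.
by move=> H x y z; have := H x y z; rewrite /star_plus !starM !starK !mulA.
Qed.

Lemma left_law_plus_comm :
  left_semibrace_law (star_plus mul star) mul star -> commutative mul.
Proof.
move=> /left_law_plusE H.
have projC p q : projection p -> projection q -> p * q = q * p.
  move=> [ps pp] [qs qq].
  have E : p * q = q * p * q * p * q.
    have := H p q q; rewrite ps qs.
    by rewrite !(mulKpp _ _ pp) !(mulKpp _ _ qq).
  by rewrite -{2}ps -{2}qs -starM E !starM ps qs !mulA.
have ssx x : x^* * x * x = x.
  have := H x (x^* * x) (x^* * x).
  by rewrite !starM !starK !mulA !(mulKxsx, mulKsxs, mulxsx, mulsxs).
have normal := star_mul_comm ssx.
(* In the law at [x], [p], [x^* * x], the left side collapses to [x * p] because [p] commutes with
   [x^* * x]; the right side becomes [p * x * p] by [ssx]. *)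
have projxp x p : projection p -> x * p = p * x * p.
  move=> pP; have [ps pp] := pP.
  have C := projC _ _ pP (projection_star_mul x).
  have := H x p (x^* * x); rewrite ps !mulA !mulKxsx.
  rewrite -(mulA _ x^* x) -(mulA x p) C !mulA mulxsx -(mulA x) pp.
  by rewrite -(mulA p) -(mulA p) ssx.
have central x p : projection p -> p * x = x * p.
  move=> pP; rewrite (projxp x p pP); case: (pP) => ps _.
  (* Starred, [projxp] at [x^*] reads [p * x = p * x * p]. *)
  by have := congr1 star (projxp x^* p pP); rewrite !starM !starK ps mulA.
(* With [z = y^*] the left side of the law contracts to [x * y^*]. On the right, the central
   projections [x^* * x] and [y^* * y] are moved until they are absorbed, which leaves [y^* * x]. *)
have commS x y : x * y^* = y^* * x.
  have := H x y y^*.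
  rewrite -(mulA _ y^* y) normal mulA mulKsxs => ->.
  rewrite -!(mulA y^*) ssx -(mulA _ x^* x) -(mulA _ (x^* * x)).
  rewrite (central y _ (projection_star_mul x)) !mulA.
  rewrite -(mulA _ y^* y) -(mulA _ x) -(central x _ (projection_star_mul y)).
  by rewrite normal !mulA mulsxs mulKxsx.
by move=> x y; rewrite -(starK y).
Qed.

Lemma right_law_plus_comm :
  right_semibrace_law (star_plus mul star) mul star -> commutative mul.
Proof.
move=> /right_law_plusE H.
have projC p q : projection p -> projection q -> p * q = q * p.
  move=> [ps pp] [qs qq].
  have E : p * q = q * p * q * p * q * p * q * p * q.
    have := H q p p; rewrite ps qs.
    by rewrite !(mulKpp _ _ pp) pp.
  by rewrite -{2}ps -{2}qs -starM E !starM ps qs !mulA.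
have ssx x : x^* * x * x = x.
  (* It is enough that [x] is a right multiple of the idempotent [x^* * x], which then fixes [x] on
     the left. *)
  have E : x = x^* * x * (x * x^* * x * x * x^* * x^* * x).
    have := H x (x * x^*) (x * x^*).
    by rewrite !starM !starK !mulA !(mulKxsx, mulKsxs, mulxsx, mulsxs).
  rewrite {3}E (mulA (x^* * x)) (mulA _ x^* x) mulsxs.
  exact: esym E.
have normal := star_mul_comm ssx.
have ssxK u v : u * v^* * v * v = u * v by rewrite -!mulA (mulA v^*) ssx.
(* Taking the projection [z^* * z] for [x] in the law turns conjugation by [z] into compression by
   that projection; multiplying by [z] on the left then yields [slide]. *)
have conj y z : z^* * y * z = z^* * z * y * (z^* * z).
  have := H (z^* * z) y z.
  rewrite !starM !starK !mulA !(mulKxsx, mulKsxs, mulxsx, mulsxs).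
  by rewrite !ssxK.
have slide y z : z^* * z * y * z = z * y * (z^* * z).
  by rewrite {1}normal -!mulA (mulA z^*) conj !mulA mulxsx.
have central z p : projection p -> p * z = z * p.
  move=> pP; have C := projC _ _ pP (projection_star_mul z).
  by have := slide p z; rewrite -C -(mulA p) ssx -mulA C !mulA mulxsx.
move=> x y; have := slide x y.
rewrite (central x _ (projection_star_mul y)) -(mulA x) ssx => ->.
by rewrite -mulA -(central x _ (projection_star_mul y)) !mulA mulxsx.
Qed.

Section Commutative.
Hypothesis mulC : commutative mul.

Let mulAC x y z : x * y * z = x * z * y.
Proof. by rewrite -!mulA (mulC y). Qed.

Lemma comm_left_law_plus : left_semibrace_law (star_plus mul star) mul star.
Proof.
move=> x y z; rewrite /star_plus !starM !starK !mulA.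
rewrite [_ * z * x^*]mulAC [_ * z * x]mulAC mulKxsx.
by rewrite [_ * x^* * x]mulAC mulKxsx (mulC _ x).
Qed.

Lemma comm_right_law_plus : right_semibrace_law (star_plus mul star) mul star.
Proof.
move=> x y z; rewrite /star_plus !starM !starK !mulA.
symmetry.
(* First [y] is carried to the right end; then the letters in [x] and [z] are brought together so
   that [x * x^* * x] and [z * z^* * z] contract. *)
rewrite [_ * y * x]mulAC [_ * y * z^*]mulAC [_ * y * x^*]mulAC.
rewrite [_ * y * z]mulAC [_ * y * x]mulAC.
rewrite [_ * z * x]mulAC [_ * z^* * x^*]mulAC [_ * z^* * x]mulAC mulKxsx.
rewrite [_ * x * z^*]mulAC [_ * x * z]mulAC mulKxsx.
rewrite [_ * z * x]mulAC [_ * z^* * x]mulAC [_ * z^* * x]mulAC.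
by rewrite (mulC x^*) mulxsx (mulC x) [_ * x * z]mulAC mulAC [_ * z * y]mulAC.
Qed.

Lemma comm_plus_semigroup : semigroup (star_plus mul star).
Proof.
split; first by case: HS => -[].
move=> a b c; rewrite /star_plus !starM !starK !mulA.
symmetry.
rewrite [_ * a * c]mulAC [_ * b * a]mulAC mulKxsx.
by rewrite mulAC.
Qed.

End Commutative.

End RegularStar.

Section Opposite.
Context (S : Type) (mul : S -> S -> S) (star : S -> S).

Lemma opposite_regular_star_semigroup : regular_star_semigroup mul star ->
  regular_star_semigroup (fun x y => mul y x) star.
Proof.
case=> -[S0 mulA] mulxsx starK starM; split=> // [|x].
  by split=> // x y z; rewrite mulA.
by rewrite mulA.
Qed.

(** Over the opposite product, [star_plus] sends [a], [b] to [a * b * a^*], which is [oplus] with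
    its arguments exchanged. Reversing both operations turns the left law into the right one. *)
Lemma opposite_left_law_oplus :
  regular_star_semigroup mul star ->
  left_semibrace_law (star_oplus mul star) mul star <->
  right_semibrace_law (star_plus (fun x y => mul y x) star)
    (fun x y => mul y x) star.
Proof.
case=> -[_ mulA] _ _ _; rewrite /star_plus /star_oplus.
by split=> H x y z; have := H x y z; rewrite !mulA.
Qed.

Lemma opposite_right_law_oplus :
  regular_star_semigroup mul star ->
  right_semibrace_law (star_oplus mul star) mul star <->
  left_semibrace_law (star_plus (fun x y => mul y x) star)
    (fun x y => mul y x) star.
Proof.
case=> -[_ mulA] _ _ _; rewrite /star_plus /star_oplus.
by split=> H x y z; have := H x y z; rewrite !mulA.
Qed.

Lemma opposite_semigroup_oplus :
  regular_star_semigroup mul star ->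
  semigroup (star_plus (fun x y => mul y x) star) ->
  semigroup (star_oplus mul star).
Proof.
case=> -[_ mulA] _ _ _; rewrite /star_plus /star_oplus => -[S0 plusA].
(* Associativity is self-dual under exchange of arguments, hence the reversed order [z y x]. *)
by split=> // x y z; have := plusA z y x; rewrite !mulA.
Qed.

End Opposite.

Theorem proposition3p9 (S : Type) (mul : S -> S -> S) (star : S -> S)
    (HS : regular_star_semigroup mul star) (bplus : S -> S -> S)
    (Hbplus : bplus = star_plus mul star \/ bplus = star_oplus mul star) :
  ((left_semibrace_law bplus mul star <-> right_semibrace_law bplus mul star)
   /\ (right_semibrace_law bplus mul star <-> commutative mul)
   /\ (left_semibrace_law bplus mul star <-> commutative mul))
  /\ (commutative mul -> semigroup bplus)
  /\ (left_regular_star_semibrace bplus mul star <-> commutative mul)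
  /\ (right_regular_star_semibrace bplus mul star <-> commutative mul)
  /\ (two_sided_regular_star_semibrace bplus mul star <-> commutative mul).
Proof.
(* Once each law is tied to commutativity, all the remaining equivalences are propositional. *)
have [left_comm right_comm semigroup_comm] :
  [/\ left_semibrace_law bplus mul star <-> commutative mul,
      right_semibrace_law bplus mul star <-> commutative mul &
      commutative mul -> semigroup bplus].
  case: Hbplus => ->.
    split; [split | split |].
    - exact: left_law_plus_comm.
    - exact: comm_left_law_plus.
    - exact: right_law_plus_comm.
    - exact: comm_right_law_plus.
    - exact: comm_plus_semigroup.
  have HSop := opposite_regular_star_semigroup _ _ _ HS.
  have opC : commutative mul <-> commutative (fun x y => mul y x).
    by split=> C x y; rewrite C.
  have left_op := opposite_left_law_oplus _ _ _ HS.
  have right_op := opposite_right_law_oplus _ _ _ HS.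
  split; [split | split |].
  - by move=> /left_op /(right_law_plus_comm _ _ _ HSop) /opC.
  - by move=> /opC C; apply/left_op; exact: comm_right_law_plus.
  - by move=> /right_op /(left_law_plus_comm _ _ _ HSop) /opC.
  - by move=> /opC C; apply/right_op; exact: comm_left_law_plus.
  - move=> /opC C; apply: opposite_semigroup_oplus => //.
    exact: comm_plus_semigroup.
rewrite /two_sided_regular_star_semibrace /left_regular_star_semibrace
  /right_regular_star_semibrace.
split; [|split; [|split; [|split]]] => //.
- tauto.
- by split=> [[_ _ /left_comm] | C] //; split; [tauto | | tauto].
- by split=> [[_ _ /right_comm] | C] //; split; [tauto | | tauto].
- by split=> [[[_ _ /left_comm]] | C] //; split; split; tauto.
Qed.
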